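(* For every integer $n\ge 1$, $$\tau(n) = \frac{65}{756} \sigma_{11}(n) + \frac{691}{756} \sigma_5(n) - \frac{2\cdot 691}{3n}\sum_{m=1}^{n-1}m\,\sigma_5(m)\sigma_5(n-m).$$
   Context: $\tau(n)$ is Ramanujan's tau function, defined by $q\prod_{n\ge 1}(1-q^n)^{24} = \sum_{n\ge 1}\tau(n)q^n$. For $k\ge 1$, $\sigma_k(n)=\sum_{d\mid n} d^k$ (sum over positive divisors of $n$). For $n=1$ the sum $\sum_{m=1}^{n-1}$ is empty and equals $0$. *)

(* Defs.v *)
From HB Require Import structures.
From mathcomp Require Import all_boot all_order all_algebra.
Set Implicit Arguments.
Unset Strict Implicit.
Unset Printing Implicit Defensive.
Import GRing.Theory.
Local Open Scope ring_scope.

Definition tau_partial (N : nat) : {poly int} :=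
  'X * \prod_(1 <= k < N.+1) (1 - 'X^k) ^+ 24.

(* The coefficient of q^n in the formal infinite product
   q * \prod_(k >= 1) (1 - q^k)^24 is the eventually constant value of the
   coefficient of q^n in the partial products; by tau_partial_stable below it
   is already attained at N = n. *)
Definition tau (n : nat) : int := (tau_partial n)`_n.

Lemma tau_partial_stable (n N : nat) :
  (n <= N)%N -> (tau_partial N)`_n = tau n.
Proof.
elim: N => [|N IHN]; first by rewrite leqn0 => /eqP ->.
rewrite leq_eqVlt => /orP[/eqP -> //|]; rewrite ltnS => le_nN.
rewrite -IHN // /tau_partial big_nat_recr //= mulrA.
set p := 'X * _.
have -> : (1 - 'X^(N.+1) : {poly int}) ^+ 24
          = 1 - 'X^(N.+1) * \sum_(i < 24) (1 - 'X^(N.+1)) ^+ i.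
  have := subrX1 (1 - 'X^(N.+1) : {poly int}) 24.
  by rewrite [1 - 'X^_ - 1]addrC addKr mulNr => /(canRL (subrK 1)) ->; rewrite addrC.
rewrite mulrBr mulr1 coefB mulrCA coefXnM ltnS le_nN subr0 //.
Qed.

Definition sigma (k n : nat) : nat := (\sum_(d <- divisors n) d ^ k)%N.

(* Main.v *)
(** Write P, Q, R for the Eisenstein series of weight 2, 4, 6 and E8 for that of weight 8.
    Summing a polynomial p with p(u,v) = p(v,u) = p(u,u-v) over the positive solutions
    of ax + by = n and applying one step of Euclid's algorithm evaluates
    sum (p(a,b) - p(a,-b)) in divisor sums (Skoruppa's method).  Such p are generated by
    u^2 - uv + v^2 and (uv(u-v))^2, and the cases of degree 4 and 6 yield, with
    theta = q d/dq, the equations 3 theta Q = PQ - R, Q^2 = E8 and 2 theta R = PR - Q^2.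
    Hence Q^3 - R^2 satisfies theta F = P F, as does the product
    q prod (1 - q^k)^24 by logarithmic differentiation; comparing first coefficients,
    Q^3 - R^2 = 1728 sum tau(n) q^n.  One invariant of degree 10 expresses the
    convolution of sigma_3 and sigma_7, i.e. Q E8 = Q^3, through that of sigma_5 with
    itself.  Power series are represented by polynomials over rat modulo 'X^N, and
    the factor m in the final sum is removed by the symmetry m <-> n - m. *)
Require Import Defs.
From HB Require Import structures.
From mathcomp Require Import all_boot all_order all_algebra.
From mathcomp Require Import zify ring lra.
Local Open Scope ring_scope.
Import GRing.Theory.

(** * Positive solutions of ax + by = n and Euclid's step *)

(** The maps need be mutually inverse only on the filtered entries; with both sequences
    duplicate-free, one filtered list is then a permutation of the image of the other. *)
Lemma big_seq_bij (I J : eqType) (V : nmodType) (s : seq I) (t : seq J)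
    (P : pred I) (Q : pred J) (h : I -> J) (h' : J -> I) (F : I -> V) (G : J -> V) :
  uniq s -> uniq t ->
  (forall i, i \in s -> P i -> [/\ h i \in t, Q (h i), h' (h i) = i & F i = G (h i)]) ->
  (forall j, j \in t -> Q j -> [/\ h' j \in s, P (h' j) & h (h' j) = j]) ->
  \sum_(i <- s | P i) F i = \sum_(j <- t | Q j) G j.
Proof.
move=> us ut hst hts; rewrite -big_filter -[RHS]big_filter.
rewrite (@eq_big_seq _ _ _ _ _ F (G \o h)); last first.
  by move=> i; rewrite mem_filter => /andP[Pi si]; case: (hst i si Pi).
rewrite -(big_map h predT G); apply/perm_big/uniq_perm; rewrite ?filter_uniq //.
  rewrite map_inj_in_uniq ?filter_uniq //; apply: (@can_in_inj _ _ _ _ h') => i.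
  by rewrite mem_filter => /andP[Pi si]; case: (hst i si Pi).
move=> j; apply/mapP/idP => [[i + ->]|]; rewrite !mem_filter => /andP.
  by case=> Pi si; case: (hst i si Pi) => -> -> _ _.
by case=> Qj tj; exists (h' j); case: (hts j tj Qj) => // si Pi _; rewrite mem_filter Pi.
Qed.

(** Entries are ((a, x), (b, y)) with ax = m and by = n - m; listing them by m and by the divisors
    a, b turns sums over solutions into convolutions of divisor sums. *)
Definition solutions (n : nat) : seq ((nat * nat) * (nat * nat)) :=
  [seq ((p.1, (m %/ p.1)%N), (p.2, ((n - m) %/ p.2)%N))
     | m <- index_iota 1 n, p <- [seq (d, e) | d <- divisors m, e <- divisors (n - m)]].

Lemma mem_solutions (n a x b y : nat) :
  (((a, x), (b, y)) \in solutions n) =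
  [&& 0 < a, 0 < x, 0 < b, 0 < y & a * x + b * y == n]%N.
Proof.
apply/allpairsPdep/idP => [[m [[d e] [+ /allpairsP[[d' e'] /= [+ + [? ?]]] []]]]|].
  subst d' e'; rewrite mem_index_iota => /andP[m_gt0 mn].
  rewrite -!dvdn_divisors ?subn_gt0 // => dm en -> -> -> ->.
  rewrite !divn_gt0 ?(dvdn_gt0 _ dm) ?(dvdn_gt0 _ en) ?subn_gt0 //.
  rewrite !(dvdn_leq _ dm) ?(dvdn_leq _ en) ?subn_gt0 //=.
  by rewrite ![(_ * (_ %/ _))%N]mulnC !divnK // subnKC // ltnW.
case/and5P=> a0 x0 b0 y0 /eqP <-.
exists (a * x)%N, (a, b); rewrite mem_index_iota addKn !mulKn //; split => //.
  by rewrite muln_gt0 a0 x0 -ltn_subLR ?subnn // ?muln_gt0 ?b0.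
by apply/allpairsP; exists (a, b); rewrite -!dvdn_divisors ?muln_gt0 ?a0 ?b0 // !dvdn_mulr.
Qed.

Lemma solutions_uniq (n : nat) : uniq (solutions n).
Proof.
apply: allpairs_uniq_dep; first exact: iota_uniq.
  by move=> m _; apply: allpairs_uniq => [| |[? ?] [? ?]]; rewrite ?divisors_uniq.
move=> p1 p2 /allpairsPdep[m [v [_ /allpairsP[[d e] /= [dm _ ->]] ->]]].
move=> /allpairsPdep[m' [w [_ /allpairsP[[d' e'] /= [dm' _ ->]] ->]]].
case=> Ed Em Ee _; subst d' e'.
(* The range of m has been dropped, so k = 0 is covered too, where [divisors] yields [[:: 1]]. *)
have div_mem k l : l \in divisors k -> (l %| k)%N.
  case: k => [|k]; first by rewrite inE => /eqP->.
  by rewrite -dvdn_divisors.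
suff -> : m = m' by [].
by rewrite -(divnK (div_mem _ _ dm)) Em divnK // div_mem.
Qed.

Lemma sum_solutions (F : nat -> nat -> rat) (n : nat) :
  \sum_(u <- solutions n) F u.1.1 u.2.1 =
  \sum_(1 <= m < n) \sum_(d <- divisors m) \sum_(e <- divisors (n - m)) F d e.
Proof.
rewrite big_allpairs_dep; apply: eq_bigr => m _.
by rewrite big_allpairs_dep.
Qed.

Lemma solutions_swap (F : nat * nat -> nat * nat -> rat) (Q : nat * nat -> nat * nat -> bool)
    (n : nat) :
  \sum_(u <- solutions n | Q u.1 u.2) F u.1 u.2
  = \sum_(u <- solutions n | Q u.2 u.1) F u.2 u.1.
Proof.
pose sw (u : (nat * nat) * (nat * nat)) := (u.2, u.1).
apply: (@big_seq_bij _ _ _ _ _ _ _ sw sw); rewrite ?solutions_uniq //.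
all: move=> [[a x] [b y]]; rewrite !mem_solutions /= => su Qu.
all: by split=> //=; lia.
Qed.

(* Euclid's subtraction step (a,x,b,y) |-> (a-b,x,b,x+y) matches the solutions
   of ax + by = n having a > b with those having y > x. *)
Lemma solutions_euclid (F : nat -> nat -> rat) (n : nat) :
  \sum_(u <- solutions n | (u.2.1 < u.1.1)%N) F u.1.1 u.2.1
  = \sum_(u <- solutions n | (u.1.2 < u.2.2)%N) F (u.1.1 + u.2.1)%N u.2.1.
Proof.
apply: (@big_seq_bij _ _ _ _ _ _ _
  (fun u => ((u.1.1 - u.2.1, u.1.2), (u.2.1, u.1.2 + u.2.2))%N)
  (fun u => ((u.1.1 + u.2.1, u.1.2), (u.2.1, u.2.2 - u.1.2))%N)).
1,2: exact: solutions_uniq.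
all: move=> [[a x] [b y]]; rewrite !mem_solutions /= => su lt_u; split.
- by nia.
- by lia.
- by congr (_, _, (_, _)); lia.
- by congr F; lia.
- by nia.
- by lia.
- by congr (_, _, (_, _)); lia.
Qed.

(** If a = b = d, then d(x + y) = n, which leaves n/d - 1 choices of x. *)
Lemma solutions_diag_coef (G : nat -> rat) (n : nat) : (0 < n)%N ->
  \sum_(u <- solutions n | (u.1.1 == u.2.1)%N) G u.1.1
  = \sum_(d <- divisors n) (n%:R / d%:R - 1) * G d.
Proof.
move=> n_gt0.
transitivity (\sum_(v <- [seq (d, x) | d <- divisors n, x <- index_iota 1 (n %/ d)]) G v.1).
  apply: (@big_seq_bij _ _ _ _ _ _ predT (fun u => u.1)
    (fun v => (v, (v.1, n %/ v.1 - v.2)%N))).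
  - exact: solutions_uniq.
  - apply: allpairs_uniq_dep; rewrite ?divisors_uniq //.
      by move=> ? _; apply: iota_uniq.
    by move=> [? ?] [? ?] _ _ [-> ->].
  - move=> [[a x] [b y]]; rewrite mem_solutions /= => + /eqP ab; subst b.
    case/and5P=> a0 x0 _ y0 /eqP En; split=> //.
      apply/allpairsPdep; exists a, x.
      rewrite -dvdn_divisors // mem_index_iota -En -mulnDr dvdn_mulr // mulKn //.
      by split => //; lia.
    by rewrite -En -mulnDr mulKn // addKn.
  - move=> v /allpairsPdep[d [x [+ + ->]]] /= _.
    rewrite -dvdn_divisors // mem_index_iota => /dvdnP[k En].
    have d_gt0 : (0 < d)%N by lia.
    by rewrite mem_solutions eqxx En mulnK //= => ?; split=> //; nia.
rewrite big_allpairs_dep; apply: eq_big_seq => d.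
rewrite -dvdn_divisors // => /dvdnP[k En]; have d_gt0 : (0 < d)%N by lia.
rewrite /= sumr_const_nat En mulnK //.
have d_neq0 : d%:R != 0 :> rat by rewrite Num.Theory.pnatr_eq0 -lt0n.
rewrite natrM mulfK //.
by rewrite -[LHS]mulr_natl natrB //; lia.
Qed.

(** If x = y, then (a + b)x = n, so d = a + b runs over the divisors of n and b over 1, ..., d -
    1. *)
Lemma solutions_diag_arg (F : nat -> nat -> rat) (n : nat) : (0 < n)%N ->
  \sum_(u <- solutions n | (u.1.2 == u.2.2)%N) F (u.1.1 + u.2.1)%N u.2.1
  = \sum_(d <- divisors n) \sum_(1 <= b < d) F d b.
Proof.
move=> n_gt0.
transitivity (\sum_(v <- [seq (d, b) | d <- divisors n, b <- index_iota 1 d]) F v.1 v.2);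
  last by rewrite big_allpairs_dep.
apply: (@big_seq_bij _ _ _ _ _ _ predT (fun u => (u.1.1 + u.2.1, u.2.1)%N)
    (fun v => ((v.1 - v.2, n %/ v.1), (v.2, n %/ v.1))%N)).
- exact: solutions_uniq.
- apply: allpairs_uniq_dep; rewrite ?divisors_uniq //.
    by move=> ? _; apply: iota_uniq.
  by move=> [? ?] [? ?] _ _ [-> ->].
- move=> [[a x] [b y]]; rewrite mem_solutions /= => + /eqP xy; subst y.
  case/and5P=> a0 x0 b0 _ /eqP En; split=> //.
    apply/allpairsPdep; exists (a + b)%N, b.
    rewrite -dvdn_divisors // mem_index_iota -En -mulnDl dvdn_mulr //.
    by split => //; lia.
  by rewrite -En -mulnDl mulKn ?addn_gt0 ?a0 // addnK.
- move=> v /allpairsPdep[d [b [+ + ->]]] /= _.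
  rewrite -dvdn_divisors // mem_index_iota => /dvdnP[k En] bd.
  have d_gt0 : (0 < d)%N by lia.
  rewrite mem_solutions eqxx En mulnK //=; split=> //; first by nia.
  by rewrite subnK //; lia.
Qed.

(* With [u = a + b], the invariance gives [p (a + b) b = p a (- b)], so Euclid's step
   cancels the off-diagonal parts of the two sums. *)
Lemma sum_solutions_invariant (p : rat -> rat -> rat) (n : nat) : (0 < n)%N ->
  (forall u v, p u v = p v u) -> (forall u v, p u v = p u (u - v)) ->
  \sum_(u <- solutions n) (p u.1.1%:R u.2.1%:R - p u.1.1%:R (- u.2.1%:R))
  = \sum_(d <- divisors n)
      (n%:R / d%:R * p d%:R d%:R - \sum_(b < d) p d%:R b%:R).
Proof.
move=> n_gt0 pC pR; rewrite sumrB.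
have trich (T : Type) (s : seq T) (f g : T -> nat) (F : T -> rat) :
  \sum_(i <- s) F i = \sum_(i <- s | (f i < g i)%N) F i
    + \sum_(i <- s | (g i < f i)%N) F i + \sum_(i <- s | f i == g i) F i.
  elim: s => [|i s IH]; first by rewrite !big_nil !addr0.
  by rewrite !big_cons IH; case: ltngtP => _; ring.
rewrite (@trich _ _ (fun u => u.1.1) (fun u => u.2.1)).
rewrite (@solutions_swap (fun v w => p v.1%:R w.1%:R) (fun v w => v.1 < w.1)%N).
under eq_bigr do rewrite pC.
rewrite (@solutions_euclid (fun a b => p a%:R b%:R)).
have pN a b : p a%:R (- b%:R) = p (a + b)%N%:R b%:R.
  by rewrite natrD [RHS]pR addrK [RHS]pC [LHS]pR opprK.
under [X in _ - X]eq_bigr do rewrite pN.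
rewrite [X in _ - X](@trich _ _ (fun u => u.1.2) (fun u => u.2.2)).
(* The part x > y is swapped onto x < y; its term [p (a + b) a] equals [p (a + b) b] by invariance,
   so both off-diagonal parts match those of the first sum. *)
rewrite [X in _ - (_ + X + _)](@solutions_swap (fun v w => p (v.1 + w.1)%N%:R w.1%:R)
  (fun v w => w.2 < v.2)%N).
have -> : \sum_(u <- solutions n | (u.1.2 < u.2.2)%N) p (u.2.1 + u.1.1)%N%:R u.1.1%:R
   = \sum_(u <- solutions n | (u.1.2 < u.2.2)%N) p (u.1.1 + u.2.1)%N%:R u.2.1%:R.
  apply: eq_bigr => u _; rewrite addnC [LHS]pR natrD.
  by rewrite [X in p _ X](_ : _ = u.2.1%:R) //; ring.
rewrite (@solutions_diag_arg (fun a b => p a%:R b%:R)) //.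
have -> : \sum_(u <- solutions n | u.1.1 == u.2.1) p u.1.1%:R u.2.1%:R
  = \sum_(u <- solutions n | u.1.1 == u.2.1) p u.1.1%:R u.1.1%:R.
  by apply: eq_bigr => u /eqP->.
rewrite (@solutions_diag_coef (fun a => p a%:R a%:R)) //.
rewrite opprD addrACA subrr add0r -sumrB; apply: eq_big_seq => d.
rewrite -dvdn_divisors // => /dvdn_gt0 -/(_ n_gt0) d_gt0.
(* The term b = 0 equals [p d d] by invariance and absorbs the - 1 of n/d - 1. *)
rewrite -(big_mkord xpredT (fun b => p d%:R b%:R)) [in RHS]big_ltn //.
by rewrite [p d%:R 0]pR subr0 /=; ring.
Qed.

(** * Divisor sums and their convolutions over [rat] *)

(* Locked: unification would otherwise compare powers in different [sigma]s. *)
HB.lock Definition sig (k n : nat) : rat := (sigma k n)%:R.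

HB.lock Definition conv (i j n : nat) : rat := \sum_(1 <= m < n) sig i m * sig j (n - m).

Lemma natr_sigma (k n : nat) : sig k n = \sum_(d <- divisors n) d%:R ^+ k.
Proof. by rewrite unlock natr_sum; apply: eq_bigr => d _; rewrite natrX. Qed.

Lemma lincomb_sigma (l : seq (rat * nat)) (n : nat) :
  \sum_(c <- l) c.1 * sig c.2 n = \sum_(d <- divisors n) \sum_(c <- l) c.1 * d%:R ^+ c.2.
Proof.
by rewrite exchange_big; apply: eq_bigr => c _; rewrite natr_sigma mulr_sumr.
Qed.

Lemma conv_solutions (i j n : nat) :
  conv i j n = \sum_(u <- solutions n) u.1.1%:R ^+ i * u.2.1%:R ^+ j.
Proof.
rewrite unlock (sum_solutions (fun d e => d%:R ^+ i * e%:R ^+ j)).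
by apply: eq_bigr => m _; rewrite !natr_sigma big_distrlr.
Qed.

Lemma convC (i j n : nat) : conv i j n = conv j i n.
Proof.
rewrite unlock big_nat_rev; apply: eq_big_nat => m /andP[_ mn].
by rewrite [LHS]mulrC add1n subSS (subKn (ltnW mn)).
Qed.

(** * Convolution identities from invariant polynomials *)

Lemma sum_telescope (f S : rat -> rat) (d : nat) :
  S 0 = 0 -> (forall x, S (x + 1) = S x + f x) -> \sum_(b < d) f b%:R = S d%:R.
Proof.
move=> S0 Sf; elim: d => [|d IHd]; first by rewrite big_ord0 S0.
by rewrite big_ord_recr /= IHd -Sf natr1.
Qed.

(* Here and below [p] is a product of powers of [u^2 - uv + v^2] and
   [(uv(u - v))^2], and [S u d] is the closed form of [\sum_(b < d) p u b]. *)
Lemma conv33 (n : nat) : (0 < n)%N ->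
  120%:R * conv 3 3 n = sig 7 n - sig 3 n.
Proof.
move=> n_gt0; pose p (u v : rat) := (u * v * (u - v)) ^+ 2.
have pC u v : p u v = p v u by rewrite /p; ring.
have pR u v : p u v = p u (u - v) by rewrite /p; ring.
have := @sum_solutions_invariant p n n_gt0 pC pR.
(* Only monomials odd in v survive, doubled; here this is - 2 u^3 v^3 alone. *)
have -> : \sum_(u <- solutions n) (p u.1.1%:R u.2.1%:R - p u.1.1%:R (- u.2.1%:R))
  = - 4%:R * conv 3 3 n.
  rewrite !conv_solutions !mulr_sumr -?big_split /=.
  by apply: eq_bigr => u _; rewrite /p; ring.
pose S (u x : rat) :=
       ((10%:R * x ^+ 3 - 15%:R * x ^+ 2 + 5%:R * x) * u ^+ 4
       + (- (15%:R * x ^+ 4) + 30%:R * x ^+ 3 - 15%:R * x ^+ 2) * u ^+ 3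
       + (6%:R * x ^+ 5 - 15%:R * x ^+ 4 + 10%:R * x ^+ 3 - x) * u ^+ 2) / 30%:R.
have sum_p u (d : nat) : \sum_(b < d) p u b%:R = S u d%:R.
  by apply: (@sum_telescope (p u) (S u)) => [|x]; rewrite /S /p; field.
(* Here [p d d] vanishes and [S d d] collapses to (d^7 - d^3)/30. *)
have -> : \sum_(d <- divisors n) (n%:R / d%:R * p d%:R d%:R - \sum_(b < d) p d%:R b%:R)
  = \sum_(c <- [:: (- 1%:R / 30%:R, 7%N);
                     (1%:R / 30%:R, 3%N)]) c.1 * sig c.2 n.
  rewrite lincomb_sigma; apply: eq_big_seq => d.
  rewrite -dvdn_divisors // => /dvdn_gt0 -/(_ n_gt0) d_gt0.
  have d_neq0 : d%:R != 0 :> rat by rewrite Num.Theory.pnatr_eq0 -lt0n.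
  by rewrite !big_cons big_nil /= sum_p /S /p; field.
rewrite !big_cons big_nil /=.
lra.
Qed.

(** The invariant of degree 4 has [p d d] = d^4, so n/d times it gives the term n sigma_3(n), the
    source of theta Q. *)
Lemma conv13 (n : nat) : (0 < n)%N ->
  240%:R * conv 1 3 n =
  21%:R * sig 5 n + 10%:R * sig 3 n - 30%:R * n%:R * sig 3 n - sig 1 n.
Proof.
move=> n_gt0; pose p (u v : rat) := (u ^+ 2 - u * v + v ^+ 2) ^+ 2.
have pC u v : p u v = p v u by rewrite /p; ring.
have pR u v : p u v = p u (u - v) by rewrite /p; ring.
have := @sum_solutions_invariant p n n_gt0 pC pR.
have -> : \sum_(u <- solutions n) (p u.1.1%:R u.2.1%:R - p u.1.1%:R (- u.2.1%:R))
  = - 4%:R * conv 1 3 n + - 4%:R * conv 3 1 n.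
  rewrite !conv_solutions !mulr_sumr -?big_split /=.
  by apply: eq_bigr => u _; rewrite /p; ring.
pose S (u x : rat) :=
       ((30%:R * x) * u ^+ 4
       + (- (30%:R * x ^+ 2) + 30%:R * x) * u ^+ 3
       + (30%:R * x ^+ 3 - 45%:R * x ^+ 2 + 15%:R * x) * u ^+ 2
       + (- (15%:R * x ^+ 4) + 30%:R * x ^+ 3 - 15%:R * x ^+ 2) * u
       + (6%:R * x ^+ 5 - 15%:R * x ^+ 4 + 10%:R * x ^+ 3 - x)) / 30%:R.
have sum_p u (d : nat) : \sum_(b < d) p u b%:R = S u d%:R.
  by apply: (@sum_telescope (p u) (S u)) => [|x]; rewrite /S /p; field.
have -> : \sum_(d <- divisors n) (n%:R / d%:R * p d%:R d%:R - \sum_(b < d) p d%:R b%:R)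
  = \sum_(c <- [:: (n%:R, 3%N);
                     (- 21%:R / 30%:R, 5%N);
                     (- 10%:R / 30%:R, 3%N);
                     (1%:R / 30%:R, 1%N)]) c.1 * sig c.2 n.
  rewrite lincomb_sigma; apply: eq_big_seq => d.
  rewrite -dvdn_divisors // => /dvdn_gt0 -/(_ n_gt0) d_gt0.
  have d_neq0 : d%:R != 0 :> rat by rewrite Num.Theory.pnatr_eq0 -lt0n.
  by rewrite !big_cons big_nil /= sum_p /S /p; field.
rewrite !big_cons big_nil /=.
rewrite (convC 3 1); lra.
Qed.

(** The odd part of the degree 6 invariant also contains u^3 v^3, whose contribution [conv33]
    eliminates. *)
Lemma conv15 (n : nat) : (0 < n)%N ->
  504%:R * conv 1 5 n =
  20%:R * sig 7 n + 21%:R * sig 5 n - 42%:R * n%:R * sig 5 n + sig 1 n.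
Proof.
move=> n_gt0; pose p (u v : rat) := (u ^+ 2 - u * v + v ^+ 2) ^+ 3.
have pC u v : p u v = p v u by rewrite /p; ring.
have pR u v : p u v = p u (u - v) by rewrite /p; ring.
have := @sum_solutions_invariant p n n_gt0 pC pR.
have -> : \sum_(u <- solutions n) (p u.1.1%:R u.2.1%:R - p u.1.1%:R (- u.2.1%:R))
  = - 6%:R * conv 1 5 n + - 6%:R * conv 5 1 n + - 14%:R * conv 3 3 n.
  rewrite !conv_solutions !mulr_sumr -?big_split /=.
  by apply: eq_bigr => u _; rewrite /p; ring.
pose S (u x : rat) :=
       ((420%:R * x) * u ^+ 6
       + (- (630%:R * x ^+ 2) + 630%:R * x) * u ^+ 5
       + (840%:R * x ^+ 3 - 1260%:R * x ^+ 2 + 420%:R * x) * u ^+ 4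
       + (- (735%:R * x ^+ 4) + 1470%:R * x ^+ 3 - 735%:R * x ^+ 2) * u ^+ 3
       + (504%:R * x ^+ 5 - 1260%:R * x ^+ 4 + 840%:R * x ^+ 3 - 84%:R * x) * u ^+ 2
       + (- (210%:R * x ^+ 6) + 630%:R * x ^+ 5 - 525%:R * x ^+ 4 + 105%:R * x ^+ 2) * u
       + (60%:R * x ^+ 7 - 210%:R * x ^+ 6 + 210%:R * x ^+ 5 - 70%:R * x ^+ 3 + 10%:R * x)) / 420%:R.
have sum_p u (d : nat) : \sum_(b < d) p u b%:R = S u d%:R.
  by apply: (@sum_telescope (p u) (S u)) => [|x]; rewrite /S /p; field.
have -> : \sum_(d <- divisors n) (n%:R / d%:R * p d%:R d%:R - \sum_(b < d) p d%:R b%:R)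
  = \sum_(c <- [:: (n%:R, 5%N);
                     (- 249%:R / 420%:R, 7%N);
                     (- 210%:R / 420%:R, 5%N);
                     (49%:R / 420%:R, 3%N);
                     (- 10%:R / 420%:R, 1%N)]) c.1 * sig c.2 n.
  rewrite lincomb_sigma; apply: eq_big_seq => d.
  rewrite -dvdn_divisors // => /dvdn_gt0 -/(_ n_gt0) d_gt0.
  have d_neq0 : d%:R != 0 :> rat by rewrite Num.Theory.pnatr_eq0 -lt0n.
  by rewrite !big_cons big_nil /= sum_p /S /p; field.
rewrite !big_cons big_nil /=.
rewrite (convC 5 1); have := @conv33 n n_gt0; lra.
Qed.

(** The factor (uv(u - v))^2 excludes the monomials u v^9 and u^9 v, and it vanishes at u = v, so no
    term with a factor n appears. *)
Lemma conv37_55 (n : nat) : (0 < n)%N ->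
  2520%:R * (4%:R * conv 3 7 n + 5%:R * conv 5 5 n)
  = 13%:R * sig 11 n - 42%:R * sig 7 n + 50%:R * sig 5 n - 21%:R * sig 3 n.
Proof.
move=> n_gt0; pose p (u v : rat) := (u ^+ 2 - u * v + v ^+ 2) ^+ 2 * (u * v * (u - v)) ^+ 2.
have pC u v : p u v = p v u by rewrite /p; ring.
have pR u v : p u v = p u (u - v) by rewrite /p; ring.
have := @sum_solutions_invariant p n n_gt0 pC pR.
have -> : \sum_(u <- solutions n) (p u.1.1%:R u.2.1%:R - p u.1.1%:R (- u.2.1%:R))
  = - 8%:R * conv 3 7 n + - 8%:R * conv 7 3 n + - 20%:R * conv 5 5 n.
  rewrite !conv_solutions !mulr_sumr -?big_split /=.
  by apply: eq_bigr => u _; rewrite /p; ring.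
pose S (u x : rat) :=
       ((210%:R * x ^+ 3 - 315%:R * x ^+ 2 + 105%:R * x) * u ^+ 8
       + (- (630%:R * x ^+ 4) + 1260%:R * x ^+ 3 - 630%:R * x ^+ 2) * u ^+ 7
       + (1008%:R * x ^+ 5 - 2520%:R * x ^+ 4 + 1680%:R * x ^+ 3 - 168%:R * x) * u ^+ 6
       + (- (1050%:R * x ^+ 6) + 3150%:R * x ^+ 5 - 2625%:R * x ^+ 4 + 525%:R * x ^+ 2) * u ^+ 5
       + (720%:R * x ^+ 7 - 2520%:R * x ^+ 6 + 2520%:R * x ^+ 5 - 840%:R * x ^+ 3 + 120%:R * x) * u ^+ 4
       + (- (315%:R * x ^+ 8) + 1260%:R * x ^+ 7 - 1470%:R * x ^+ 6 + 735%:R * x ^+ 4 - 210%:R * x ^+ 2) * u ^+ 3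
       + (70%:R * x ^+ 9 - 315%:R * x ^+ 8 + 420%:R * x ^+ 7 - 294%:R * x ^+ 5 + 140%:R * x ^+ 3 - 21%:R * x) * u ^+ 2) / 630%:R.
have sum_p u (d : nat) : \sum_(b < d) p u b%:R = S u d%:R.
  by apply: (@sum_telescope (p u) (S u)) => [|x]; rewrite /S /p; field.
have -> : \sum_(d <- divisors n) (n%:R / d%:R * p d%:R d%:R - \sum_(b < d) p d%:R b%:R)
  = \sum_(c <- [:: (- 13%:R / 630%:R, 11%N);
                     (42%:R / 630%:R, 7%N);
                     (- 50%:R / 630%:R, 5%N);
                     (21%:R / 630%:R, 3%N)]) c.1 * sig c.2 n.
  rewrite lincomb_sigma; apply: eq_big_seq => d.
  rewrite -dvdn_divisors // => /dvdn_gt0 -/(_ n_gt0) d_gt0.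
  have d_neq0 : d%:R != 0 :> rat by rewrite Num.Theory.pnatr_eq0 -lt0n.
  by rewrite !big_cons big_nil /= sum_p /S /p; field.
rewrite !big_cons big_nil /=.
rewrite (convC 7 3) => E.
transitivity (- 630%:R
  * (- 8%:R * conv 3 7 n + - 8%:R * conv 3 7 n + - 20%:R * conv 5 5 n)); first by ring.
by rewrite E; field.
Qed.

(** * Truncated power series and the operator theta *)

Definition theta (p : {poly rat}) : {poly rat} := 'X * p^`().

Lemma thetaD (p q : {poly rat}) : theta (p + q) = theta p + theta q.
Proof. by rewrite /theta derivD mulrDr. Qed.

Lemma thetaN (p : {poly rat}) : theta (- p) = - theta p.
Proof. by rewrite /theta derivN mulrN. Qed.

Lemma thetaM (p q : {poly rat}) : theta (p * q) = theta p * q + p * theta q.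
Proof. by rewrite /theta derivM mulrDr mulrA mulrCA. Qed.

Lemma theta_natr (m : nat) : theta m%:R = 0.
Proof. by rewrite /theta -polyC_natr derivC mulr0. Qed.

Lemma coef_theta (p : {poly rat}) (m : nat) : (theta p)`_m = m%:R * p`_m.
Proof. by case: m => [|m]; rewrite /theta coefXM ?mul0r //= coef_deriv mulr_natl. Qed.

Lemma coef_natrM (c : nat) (p : {poly rat}) (m : nat) : (c%:R * p)`_m = c%:R * p`_m.
Proof. by rewrite mulr_natl coefMn mulr_natl. Qed.

Lemma coef1M (p q : {poly rat}) : (p * q)`_1 = p`_0 * q`_1 + p`_1 * q`_0.
Proof. by rewrite coefM !big_ord_recl big_ord0 addr0. Qed.

Lemma dvdXnP (N : nat) (p : {poly rat}) :
  reflect (forall m, (m < N)%N -> p`_m = 0) ('X^N %| p).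
Proof.
apply: (iffP idP) => [/Pdiv.Field.dvdpP[q ->] m mN|p0]; first by rewrite coefMXn mN.
rewrite -(poly_take_drop N p); have -> : take_poly N p = 0.
  by apply/polyP => m; rewrite coef_take_poly coef0; case: ifP => // /p0.
by rewrite add0r Pdiv.Field.dvdp_mull.
Qed.

(* [divisors 0 = [:: 1]], hence the constant coefficient is set apart. *)
Definition sig_poly (k N : nat) : {poly rat} :=
  \poly_(m < N) (if (0 < m)%N then sig k m else 0).

Lemma sig_poly0 (k N : nat) : (sig_poly k N)`_0 = 0.
Proof. by rewrite coef_poly /= if_same. Qed.

Lemma coef_sig_poly (k : nat) [N m : nat] : (m.+1 < N)%N -> (sig_poly k N)`_m.+1 = sig k m.+1.
Proof. by move=> mN; rewrite coef_poly mN. Qed.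

Lemma coef_sig_polyM (i j : nat) [N m : nat] : (m.+1 < N)%N ->
  (sig_poly i N * sig_poly j N)`_m.+1 = conv i j m.+1.
Proof.
move=> mN; rewrite coefM -(big_mkord xpredT (fun l => (sig_poly i N)`_l * (sig_poly j N)`_(m.+1 - l))) [conv]unlock.
rewrite big_nat_recr //= subnn sig_poly0 mulr0 addr0 big_ltn // sig_poly0 mul0r add0r.
apply: eq_big_nat => l /andP[l_gt0 lm].
rewrite !coef_poly l_gt0 subn_gt0 lm (ltn_trans lm mN).
by rewrite (leq_ltn_trans (leq_subr _ _) mN).
Qed.

(** Multiplied by 480, this is Q^2 = E8 with E8 = 1 + 480 sum sigma_7(m) q^m. *)
Lemma dvd_sig_poly33 (N : nat) :
  'X^N %| 120%:R * (sig_poly 3 N * sig_poly 3 N) - (sig_poly 7 N - sig_poly 3 N).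
Proof.
apply/dvdXnP => -[|m] mN; rewrite !(coefB, coefD) !coef_natrM ?coef_theta.
  by rewrite coef0M !sig_poly0; ring.
by rewrite (coef_sig_polyM _ _ mN) !(coef_sig_poly _ mN) (@conv33 m.+1 isT); ring.
Qed.

(** Multiplied by 24, this is 3 theta Q = PQ - R. *)
Lemma dvd_sig_poly13 (N : nat) :
  'X^N %| 240%:R * (sig_poly 1 N * sig_poly 3 N)
    - (21%:R * sig_poly 5 N + 10%:R * sig_poly 3 N - 30%:R * theta (sig_poly 3 N) - sig_poly 1 N).
Proof.
apply/dvdXnP => -[|m] mN; rewrite !(coefB, coefD) !coef_natrM ?coef_theta.
  by rewrite coef0M !sig_poly0; ring.
by rewrite (coef_sig_polyM _ _ mN) !(coef_sig_poly _ mN) (@conv13 m.+1 isT); ring.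
Qed.

(** Multiplied by 24, this is 2 theta R = PR - E8. *)
Lemma dvd_sig_poly15 (N : nat) :
  'X^N %| 504%:R * (sig_poly 1 N * sig_poly 5 N)
    - (20%:R * sig_poly 7 N + 21%:R * sig_poly 5 N - 42%:R * theta (sig_poly 5 N) + sig_poly 1 N).
Proof.
apply/dvdXnP => -[|m] mN; rewrite !(coefB, coefD) !coef_natrM ?coef_theta.
  by rewrite coef0M !sig_poly0; ring.
by rewrite (coef_sig_polyM _ _ mN) !(coef_sig_poly _ mN) (@conv15 m.+1 isT); ring.
Qed.

(** * Eisenstein series and the differential equation for Q^3 - R^2 *)

Definition eisP (N : nat) : {poly rat} := 1 - 24%:R * sig_poly 1 N.
Definition eisQ (N : nat) : {poly rat} := 1 + 240%:R * sig_poly 3 N.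
Definition eisR (N : nat) : {poly rat} := 1 - 504%:R * sig_poly 5 N.

Definition discr (N : nat) : {poly rat} := eisQ N * eisQ N * eisQ N - eisR N * eisR N.

(** theta(Q^3 - R^2) = 3 Q^2 theta Q - 2 R theta R = Q^2 (PQ - R) - R (PR - Q^2), where the mixed
    terms cancel. *)
Lemma theta_discr (N : nat) : 'X^N %| theta (discr N) - eisP N * discr N.
Proof.
have A := dvd_sig_poly33 N; have B := dvd_sig_poly13 N; have C := dvd_sig_poly15 N.
set a := (X in _ %| X) in A; set b := (X in _ %| X) in B; set c := (X in _ %| X) in C.
(* The multipliers reflect 24 b = 3 theta Q - PQ + R, 480 a = Q^2 - E8 and 24 c = PR - E8 - 2 theta
   R. *)
have -> : theta (discr N) - eisP N * discr N =
  24%:R * eisQ N * eisQ N * b - eisR N * 480%:R * a + eisR N * 24%:R * c.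
  rewrite /a /b /c /discr /eisP /eisQ /eisR.
  rewrite !(thetaD, thetaN, thetaM, theta_natr, theta_natr 1).
  ring.
apply: Pdiv.Field.dvdp_add; last exact: Pdiv.Field.dvdp_mull.
by apply: Pdiv.Field.dvdp_sub; apply: Pdiv.Field.dvdp_mull.
Qed.

(** * Logarithmic derivative of the product *)

Lemma geometric_sum (k M : nat) :
  (1 - 'X^k) * \sum_(1 <= j < M.+1) 'X^(k * j) = 'X^k - 'X^(k * M.+1) :> {poly rat}.
Proof.
elim: M => [|M IHM]; first by rewrite big_geq // muln1 mulr0 subrr.
by rewrite big_nat_recr //= mulrDr IHM mulrBl mul1r -exprD -mulnS addrA subrK.
Qed.

(* Logarithmic derivative of a partial product, with k q^k/(1-q^k) expanded as a
   geometric series. *)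
Lemma theta_prod (N K : nat) :
  let F := 'X * \prod_(1 <= k < K.+1) (1 - 'X^k) ^+ 24 in
  'X^N %| theta F
    - (1 - 24%:R * \sum_(1 <= k < K.+1) k%:R * \sum_(1 <= j < N.+1) 'X^(k * j)) * F.
Proof.
elim: K => [|K IHK] /=.
  rewrite !big_geq // mulr1 mulr0 subr0 mul1r /theta derivX mulr1 subrr.
  exact: Pdiv.Field.dvdp0.
rewrite !(@big_nat_recr _ _ _ K.+1) //=; move: IHK => /=.
set F := 'X * \prod_(1 <= k < K.+1) _; set S := \sum_(1 <= k < K.+1) _.
rewrite mulrA -/F; set L := \sum_(1 <= j < N.+1) _; set e := 1 - 'X^(K.+1).
move=> IHK.
have theta_e : theta (e ^+ 24) = 24%:R * e ^+ 23 * (- (K.+1%:R * 'X^(K.+1))).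
  rewrite /theta deriv_exp /e derivB derivXn derivC sub0r [LHS]/=.
  rewrite -[_ *+ K.+1]mulr_natl -[_ *+ 24]mulr_natl (exprS _ K).
  ring.
have eL : e * L = 'X^(K.+1) - 'X^(K.+1 * N.+1) by apply: geometric_sum.
(* Truncating the geometric series leaves an error of order (K + 1)(N + 1), at least N. *)
have -> : theta (F * e ^+ 24) - (1 - 24%:R * (S + K.+1%:R * L)) * (F * e ^+ 24)
  = e ^+ 24 * (theta F - (1 - 24%:R * S) * F)
    - 24%:R * K.+1%:R * F * e ^+ 23 * 'X^(K.+1 * N.+1).
  by rewrite thetaM theta_e (exprS _ 23); ring: eL.
apply: Pdiv.Field.dvdp_sub; apply: Pdiv.Field.dvdp_mull => //.
by apply: Pdiv.Field.dvdp_exp2l; lia.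
Qed.

(** Collecting the pairs (k, j) with kj = m yields each divisor k of m once; for m < N the bounds k,
    j <= N lose nothing. *)
Lemma lambert_sig_poly (N : nat) :
  'X^N %| \sum_(1 <= k < N.+1) k%:R * \sum_(1 <= j < N.+1) 'X^(k * j) - sig_poly 1 N.
Proof.
apply/dvdXnP => m mN; rewrite coefB coef_sum coef_poly mN.
under eq_bigr do rewrite mulr_sumr coef_sum.
pose t := [seq (k, j) | k <- index_iota 1 N.+1, j <- index_iota 1 N.+1].
rewrite (_ : \sum_(1 <= k < N.+1) _
  = \sum_(v <- t) (v.1%:R * 'X^(v.1 * v.2) : {poly rat})`_m); last by rewrite big_allpairs_dep.
have memt k j : ((k, j) \in t) = (0 < k < N.+1)%N && (0 < j < N.+1)%N.
  apply/allpairsPdep/idP => [[k' [j' [+ + [-> ->]]]]|/andP[k_in j_in]].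
    by rewrite !mem_index_iota => -> ->.
  by exists k, j; rewrite !mem_index_iota.
have -> : \sum_(v <- t) (v.1%:R * 'X^(v.1 * v.2) : {poly rat})`_m
  = \sum_(v <- t | m == (v.1 * v.2)%N) v.1%:R.
  rewrite [RHS]big_mkcond; apply: eq_bigr => v _.
  by rewrite coef_natrM coefXn; case: eqP; rewrite ?mulr1 ?mulr0.
case: ifP => [m_gt0|m0]; last first.
  rewrite big1_seq ?subrr // => -[k j] /andP[/= /eqP Em]; rewrite memt; nia.
rewrite natr_sigma; apply/eqP; rewrite subr_eq0; apply/eqP.
apply: (@big_seq_bij _ _ _ _ _ _ predT fst (fun d => (d, m %/ d)%N)).
- apply: allpairs_uniq_dep => [|k _|]; rewrite ?iota_uniq //.
  by move=> [? ?] [? ?] _ _ [-> ->].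
- exact: divisors_uniq.
- move=> [k j]; rewrite memt /= => kj /eqP Em.
  have k_gt0 : (0 < k)%N by lia.
  by rewrite -dvdn_divisors // Em dvdn_mulr // mulKn // expr1.
- move=> d; rewrite -dvdn_divisors // => dm _.
  rewrite memt /= mulnC divnK //; split=> //.
  have d_gt0 := dvdn_gt0 m_gt0 dm; have d_le := dvdn_leq m_gt0 dm.
  rewrite d_gt0 divn_gt0 // d_le !ltnS /=.
  by rewrite (ltnW (leq_ltn_trans d_le mN)) (ltnW (leq_ltn_trans (leq_div m d) mN)).
Qed.

Definition discr_prod (N : nat) : {poly rat} := map_poly intr (tau_partial N).

Lemma theta_discr_prod (N : nat) :
  'X^N %| theta (discr_prod N) - eisP N * discr_prod N.
Proof.
have -> : discr_prod N = 'X * \prod_(1 <= k < N.+1) (1 - 'X^k) ^+ 24.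
  rewrite /discr_prod /tau_partial rmorphM rmorph_prod /= map_polyX; congr (_ * _).
  by apply: eq_bigr => k _; rewrite rmorphXn rmorphB rmorph1 /= map_polyXn.
have := theta_prod N N; have := lambert_sig_poly N.
set F := 'X * _; set L := \sum_(1 <= k < N.+1) _ => /= dvdL dvdF.
have -> : theta F - eisP N * F
  = theta F - (1 - 24%:R * L) * F - 24%:R * F * (L - sig_poly 1 N).
  by rewrite /eisP; ring.
by apply: Pdiv.Field.dvdp_sub => //; apply: Pdiv.Field.dvdp_mull.
Qed.

(* Since the constant coefficient of [p] is [1], the equation at [q^m] reads
   [(m - 1) w_m =] a combination of the [w_l], [l < m]. *)
Lemma theta_eq_unique (N : nat) (p w : {poly rat}) :
  'X^N %| theta w - p * w -> p`_0 = 1 -> w`_0 = 0 -> w`_1 = 0 -> 'X^N %| w.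
Proof.
move=> /dvdXnP ode p0 w0 w1; apply/dvdXnP => m.
elim/ltn_ind: m => -[|[|m]] // IHm mN.
have := ode _ mN; rewrite coefB coef_theta coefM big_ord_recl p0 mul1r subn0.
rewrite big1 => [|l _]; last first.
  by rewrite lift0 subSS IHm ?mulr0 //; lia.
rewrite addr0 -[X in _ - X]mul1r -mulrBl -(natr1 m.+1) addrK.
by move/eqP; rewrite mulf_eq0 Num.Theory.pnatr_eq0 /= => /eqP.
Qed.

(** * First coefficients and the identification of Q^3 - R^2 *)

Lemma discr_prod_coef (n N : nat) : (n <= N)%N -> (discr_prod N)`_n = (tau n)%:~R.
Proof. by move=> nN; rewrite coef_map /= tau_partial_stable. Qed.

Lemma tau_1 : tau 1 = 1.
Proof.
by rewrite /tau /tau_partial big_nat1 coefXM /= -horner_coef0 !hornerE.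
Qed.

Lemma eisQ_0 (N : nat) : (eisQ N)`_0 = 1.
Proof. by rewrite coefD coef_natrM sig_poly0 coef1 mulr0 addr0. Qed.

Lemma eisR_0 (N : nat) : (eisR N)`_0 = 1.
Proof. by rewrite coefB coef_natrM sig_poly0 coef1 mulr0 subr0. Qed.

Lemma eisQ_1 (N : nat) (N_gt1 : (1 < N)%N) : (eisQ N)`_1 = 240%:R.
Proof.
rewrite coefD coef_natrM (coef_sig_poly _ N_gt1) coef1 natr_sigma big_seq1 expr1n [LHS]/=.
ring.
Qed.

Lemma eisR_1 (N : nat) (N_gt1 : (1 < N)%N) : (eisR N)`_1 = - 504%:R.
Proof.
rewrite coefB coef_natrM (coef_sig_poly _ N_gt1) coef1 natr_sigma big_seq1 expr1n [LHS]/=.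
ring.
Qed.

Lemma discr_0 (N : nat) : (discr N)`_0 = 0.
Proof. by rewrite coefB !coef0M eisQ_0 eisR_0 !mulr1 subrr. Qed.

(** 1728 = 3 * 240 + 2 * 504, from Q^3 and R^2 respectively. *)
Lemma discr_1 (N : nat) (N_gt1 : (1 < N)%N) : (discr N)`_1 = 1728%:R.
Proof.
rewrite coefB !coef1M coef0M eisQ_0 eisR_0 (eisQ_1 _ N_gt1) (eisR_1 _ N_gt1).
ring.
Qed.

Lemma discr_prod_0 (N : nat) : (discr_prod N)`_0 = 0.
Proof. by rewrite discr_prod_coef // /tau coefXM. Qed.

Lemma discr_prod_1 (N : nat) : (0 < N)%N -> (discr_prod N)`_1 = 1.
Proof. by move=> N_gt0; rewrite discr_prod_coef // tau_1. Qed.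

(** The equation theta w = P w is linear, so the difference satisfies it as well, and its first two
    coefficients vanish. *)
Lemma discr_eq (N : nat) : (1 < N)%N -> 'X^N %| discr N - 1728%:R * discr_prod N.
Proof.
move=> N_gt1; apply: (@theta_eq_unique _ (eisP N)).
- have := theta_discr N; have := theta_discr_prod N.
  set a := (X in _ %| X) => dvda; set b := (X in _ %| X) => dvdb.
  have -> : theta (discr N - 1728%:R * discr_prod N)
      - eisP N * (discr N - 1728%:R * discr_prod N) = b - 1728%:R * a.
    by rewrite thetaD thetaN thetaM theta_natr /a /b; ring.
  by apply: Pdiv.Field.dvdp_sub => //; apply: Pdiv.Field.dvdp_mull.
- by rewrite coefB coef_natrM sig_poly0 coef1 mulr0 subr0.
- by rewrite coefB coef_natrM discr_0 discr_prod_0 mulr0 subrr.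
- by rewrite coefB coef_natrM (discr_1 _ N_gt1) (discr_prod_1 _ (ltnW N_gt1)) mulr1 subrr.
Qed.

(** * The formula for tau *)

Lemma tau_conv (n : nat) : (0 < n)%N ->
  (tau n)%:~R = 65%:R / 756%:R * sig 11 n + 691%:R / 756%:R * sig 5 n
                - 691%:R / 3%:R * conv 5 5 n :> rat.
Proof.
move=> n_gt0; rewrite -(prednK n_gt0); move: n.-1 => {n_gt0}n; pose N := n.+2.
have nN : (n.+1 < N)%N by [].
set a := 120%:R * (sig_poly 3 N * sig_poly 3 N) - (sig_poly 7 N - sig_poly 3 N).
have a_coef : (480%:R * eisQ N * a)`_n.+1 = 0.
  apply: (elimT (dvdXnP N _) _ _ nN).
  exact/Pdiv.Field.dvdp_mull/dvd_sig_poly33.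
(* Q^3 is replaced by Q E8, at the cost of the multiple 480 Q a of [a], which is invisible below
   ['X^N]. *)
have discrE : discr N = 240%:R * sig_poly 3 N + 480%:R * sig_poly 7 N
     + 240%:R * (480%:R * (sig_poly 3 N * sig_poly 7 N))
     + 504%:R * (2%:R * sig_poly 5 N) - 504%:R * (504%:R * (sig_poly 5 N * sig_poly 5 N))
     + 480%:R * eisQ N * a.
  by rewrite /discr /eisQ /eisR /a; ring.
have := elimT (dvdXnP N _) (@discr_eq N isT) _ nN.
rewrite discrE coefB coef_natrM (@discr_prod_coef n.+1 N (ltnW nN)) coefD a_coef.
rewrite !(coefB, coefD) !coef_natrM !(coef_sig_polyM _ _ nN) !(coef_sig_poly _ nN).
have := @conv37_55 n.+1 isT.
move: (conv 3 7 _) (conv 5 5 _) (sig 3 _) (sig 5 _) (sig 7 _) (sig 11 _) (_%:~R).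
move=> c37 c55 s3 s5 s7 s11 t E37 Et.
(* Eliminating [c37] through [E37] also cancels [s3] and [s7]. *)
lra.
Qed.

(** In two copies of the sum, one of them reversed, the weights m and n - m add up to n. *)
Lemma sum_weighted_conv (n : nat) :
  \sum_(1 <= m < n) m%:R * (sigma 5 m)%:R * (sigma 5 (n - m))%:R
  = n%:R / 2%:R * conv 5 5 n :> rat.
Proof.
set S := LHS; suff : S + S = n%:R * conv 5 5 n by lra.
rewrite {2}/S big_nat_rev -big_split [conv]unlock mulr_sumr; apply: eq_big_nat => m /andP[_ mn] /=.
rewrite add1n subSS (subKn (ltnW mn)) natrB ?(ltnW mn) // sig.unlock; ring.
Qed.

Theorem theorem2p3 (n : nat) (hn : (1 <= n)%N) :
  (tau n)%:~R =
    65%:R / 756%:R * (sigma 11 n)%:R + 691%:R / 756%:R * (sigma 5 n)%:R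
    - (2%:R * 691%:R) / (3%:R * n%:R)
      * \sum_(1 <= m < n) m%:R * (sigma 5 m)%:R * (sigma 5 (n - m))%:R :> rat.
Proof.
have n_neq0 : n%:R != 0 :> rat by rewrite Num.Theory.pnatr_eq0 -lt0n.
rewrite sum_weighted_conv (tau_conv _ hn) sig.unlock; congr (_ - _).
by field.
Qed.
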